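(* ($\mathsf{CZF}$) The Axiom of Double Complement $\mathsf{DCom}$ implies the Axiom of Power Set $\mathsf{Pow}$. That is, $\mathsf{CZF}+\mathsf{DCom}$ proves that for every set $a$ the class $\{b \mid b\subseteq a\}$ is a set.
   Context: The logic is intuitionistic. $\mathsf{CZF}$ is the intuitionistic theory in the language of set theory with axioms Extensionality, Pairing, Union, Infinity, the $\in$-Induction scheme, $\Delta_0$-Separation, Strong Collection (if $\forall x\in a\,\exists y\,\phi(x,y)$ then there is a set $b$ with $\forall x\in a\,\exists y\in b\,\phi(x,y)$ and $\forall y\in b\,\exists x\in a\,\phi(x,y)$), and Subset Collection (for all sets $a,b$ there is a set $c$ such that for all $u$, if $\forall x\in a\,\exists y\in b\,\phi(x,y,u)$ then there is $d\in c$ with $\forall x\in a\,\exists y\in d\,\phi(x,y,u)$ and $\forall y\in d\,\exists x\in a\,\phi(x,y,u)$). $\mathsf{DCom}$ states that every set has a double complement: $\forall x\,\exists y\,\forall z\,(\neg\neg(z\in x)\to z\in y)$. *)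

(* Defs.v *)
From Stdlib Require Import List Arith.
Import ListNotations.

(* Formulas of first-order set theory with equality, with de Bruijn indices:
   index 0 is the variable bound by the innermost enclosing quantifier.  The
   language has no function symbols, so every term is a variable and every
   substitution is a renaming. *)
Inductive form : Type :=
| Bot : form
| Mem : nat -> nat -> form
| Eq : nat -> nat -> form
| And : form -> form -> form
| Or : form -> form -> form
| Imp : form -> form -> form
| All : form -> form
| Ex : form -> form.

Declare Scope form_scope.
Delimit Scope form_scope with form.
Bind Scope form_scope with form.
Local Open Scope form_scope.

Definition Neg (φ : form) : form := Imp φ Bot.
Definition Iff (φ ψ : form) : form := And (Imp φ ψ) (Imp ψ φ).

Infix "∈" := Mem (at level 70, no associativity) : form_scope.
Infix "≐" := Eq (at level 70, no associativity) : form_scope.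
Notation "¬ φ" := (Neg φ) (at level 75, right associativity) : form_scope.
Infix "∧" := And (at level 80, right associativity) : form_scope.
Infix "∨" := Or (at level 85, right associativity) : form_scope.
Infix "⇒" := Imp (at level 90, right associativity) : form_scope.
Infix "⇔" := Iff (at level 95, no associativity) : form_scope.

(* In [AllIn a φ] and [ExIn a φ], the index [a] is read outside the
   quantifier, so the bound variable cannot be its own bound. *)
Definition AllIn (a : nat) (φ : form) : form := All (0 ∈ S a ⇒ φ).
Definition ExIn (a : nat) (φ : form) : form := Ex (0 ∈ S a ∧ φ).

Definition up (f : nat -> nat) (n : nat) : nat :=
  match n with 0 => 0 | S m => S (f m) end.

Fixpoint ren (f : nat -> nat) (φ : form) : form :=
  match φ with
  | Bot => Bot
  | Mem i j => Mem (f i) (f j)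
  | Eq i j => Eq (f i) (f j)
  | And φ ψ => And (ren f φ) (ren f ψ)
  | Or φ ψ => Or (ren f φ) (ren f ψ)
  | Imp φ ψ => Imp (ren f φ) (ren f ψ)
  | All φ => All (ren (up f) φ)
  | Ex φ => Ex (ren (up f) φ)
  end.

(* [pick [x0; ...; xm] k] sends 0, ..., m to x0, ..., xm and the remaining
   indices m+1, m+2, ... to k, k+1, ... *)
Fixpoint pick (l : list nat) (k n : nat) : nat :=
  match l, n with
  | [], _ => k + n
  | x :: _, 0 => x
  | _ :: l', S n' => pick l' k n'
  end.

Definition inst (t : nat) (φ : form) : form := ren (pick [t] 0) φ.
Definition shift (φ : form) : form := ren S φ.

(* Natural deduction for intuitionistic first-order logic with equality. *)
Inductive prv : list form -> form -> Prop :=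
| prv_hyp Γ φ : In φ Γ -> prv Γ φ
| prv_botE Γ φ : prv Γ Bot -> prv Γ φ
| prv_andI Γ φ ψ : prv Γ φ -> prv Γ ψ -> prv Γ (φ ∧ ψ)
| prv_andEl Γ φ ψ : prv Γ (φ ∧ ψ) -> prv Γ φ
| prv_andEr Γ φ ψ : prv Γ (φ ∧ ψ) -> prv Γ ψ
| prv_orIl Γ φ ψ : prv Γ φ -> prv Γ (φ ∨ ψ)
| prv_orIr Γ φ ψ : prv Γ ψ -> prv Γ (φ ∨ ψ)
| prv_orE Γ φ ψ χ :
    prv Γ (φ ∨ ψ) -> prv (φ :: Γ) χ -> prv (ψ :: Γ) χ -> prv Γ χ
| prv_impI Γ φ ψ : prv (φ :: Γ) ψ -> prv Γ (φ ⇒ ψ)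
| prv_impE Γ φ ψ : prv Γ (φ ⇒ ψ) -> prv Γ φ -> prv Γ ψ
| prv_allI Γ φ : prv (map shift Γ) φ -> prv Γ (All φ)
| prv_allE Γ φ t : prv Γ (All φ) -> prv Γ (inst t φ)
| prv_exI Γ φ t : prv Γ (inst t φ) -> prv Γ (Ex φ)
| prv_exE Γ φ χ : prv Γ (Ex φ) -> prv (φ :: map shift Γ) (shift χ) -> prv Γ χ
| prv_eqI Γ t : prv Γ (t ≐ t)
| prv_eqE Γ φ s t : prv Γ (s ≐ t) -> prv Γ (inst s φ) -> prv Γ (inst t φ).

Definition theory : Type := form -> Prop.

Definition proves (T : theory) (φ : form) : Prop :=
  exists Γ : list form, (forall ψ, In ψ Γ -> T ψ) /\ prv Γ φ.

Definition extend (T : theory) (χ : form) : theory := fun φ => T φ \/ φ = χ.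

(* The least n such that all free indices of φ are smaller than n. *)
Fixpoint bound (φ : form) : nat :=
  match φ with
  | Bot => 0
  | Mem i j | Eq i j => Nat.max (S i) (S j)
  | And φ ψ | Or φ ψ | Imp φ ψ => Nat.max (bound φ) (bound ψ)
  | All φ | Ex φ => Nat.pred (bound φ)
  end.

Definition closure (φ : form) : form := Nat.iter (bound φ) All φ.

Inductive delta0 : form -> Prop :=
| delta0_bot : delta0 Bot
| delta0_mem i j : delta0 (i ∈ j)
| delta0_eq i j : delta0 (i ≐ j)
| delta0_and φ ψ : delta0 φ -> delta0 ψ -> delta0 (φ ∧ ψ)
| delta0_or φ ψ : delta0 φ -> delta0 ψ -> delta0 (φ ∨ ψ)
| delta0_imp φ ψ : delta0 φ -> delta0 ψ -> delta0 (φ ⇒ ψ)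
| delta0_all a φ : delta0 φ -> delta0 (AllIn a φ)
| delta0_ex a φ : delta0 φ -> delta0 (ExIn a φ).

(* The comments below name the quantified variables from the outside in. *)

(* x y; z *)
Definition Extensionality : form :=
  All (All (All (0 ∈ 2 ⇔ 0 ∈ 1) ⇒ 1 ≐ 0)).

(* a b c x *)
Definition Pairing : form :=
  All (All (Ex (All (0 ∈ 1 ⇔ 0 ≐ 3 ∨ 0 ≐ 2)))).

(* a b x; u *)
Definition Union : form :=
  All (Ex (All (0 ∈ 1 ⇔ ExIn 2 (1 ∈ 0)))).

(* There is a set w that contains the empty set and, with every v, the set
   s = v ∪ {v}.  Variables: w; z u in the first conjunct, v s u in the
   second. *)
Definition Infinity : form :=
  Ex (ExIn 0 (All (¬ 0 ∈ 1))
      ∧ AllIn 0 (ExIn 1 (All (0 ∈ 1 ⇔ 0 ∈ 2 ∨ 0 ≐ 2)))).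

(* Index 0 of φ is the induction variable, the others are parameters. *)
Definition Induction (φ : form) : form :=
  All (AllIn 0 (ren (pick [0] 2) φ) ⇒ φ) ⇒ All φ.

(* a b x.  Indices 0, 1 of φ are x, a, the others are parameters; the renaming
   skips b, which must not occur in φ. *)
Definition Separation (φ : form) : form :=
  All (Ex (All (0 ∈ 1 ⇔ 0 ∈ 2 ∧ ren (pick [0] 2) φ))).

(* a; then x y in the premise, and b followed by x y, respectively y x, in the
   conclusion.  Indices 0, 1, 2 of φ are y, x, a, the others are parameters. *)
Definition StrongCollection (φ : form) : form :=
  All (AllIn 0 (Ex φ)
       ⇒ Ex (AllIn 1 (ExIn 1 (ren (pick [0; 1] 3) φ))
             ∧ AllIn 0 (ExIn 2 (ren (pick [1; 0] 3) φ)))).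

(* a b c u; then x y in the premise, and d followed by x y, respectively y x,
   in the conclusion.  Indices 0, ..., 4 of φ are y, x, u, b, a, the others are
   parameters. *)
Definition SubsetCollection (φ : form) : form :=
  All (All (Ex (All
    (AllIn 3 (ExIn 3 (ren (pick [0; 1; 2] 4) φ))
     ⇒ ExIn 1 (AllIn 4 (ExIn 1 (ren (pick [0; 1; 3] 5) φ))
               ∧ AllIn 0 (ExIn 5 (ren (pick [1; 0; 3] 5) φ))))))).

Inductive CZF : theory :=
| CZF_extensionality : CZF Extensionality
| CZF_pairing : CZF Pairing
| CZF_union : CZF Union
| CZF_infinity : CZF Infinity
| CZF_induction φ : CZF (closure (Induction φ))
| CZF_separation φ : delta0 φ -> CZF (closure (Separation φ))
| CZF_strong_collection φ : CZF (closure (StrongCollection φ))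
| CZF_subset_collection φ : CZF (closure (SubsetCollection φ)).

(* x y z *)
Definition DCom : form := All (Ex (All (¬ ¬ 0 ∈ 2 ⇒ 0 ∈ 1))).

(* a y b; x.  The subformula [AllIn 0 (0 ∈ 3)] says that b ⊆ a. *)
Definition Pow : form := All (Ex (All (0 ∈ 1 ⇔ AllIn 0 (0 ∈ 3)))).

(* Main.v *)
From Stdlib Require Import List Arith Lia.
Import ListNotations.
Require Import Defs.
Local Open Scope form_scope.

(** Let [a] be a set.  Every [s ⊆ {x}] satisfies [¬¬ (s = ∅ ∨ s = {x})], since
    [¬¬ (x ∈ s ∨ ¬ x ∈ s)] is an intuitionistic tautology.  Hence a double
    complement of the pair [{∅, {x}}] contains all subsets of [{x}]
    ([subsets_of_singleton]): this is the only place where [DCom] enters.  By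
    Strong Collection and Union one set [B] contains all subsets of all
    singletons [{x}] with [x ∈ a] ([subsets_of_singletons]).

    Subset Collection passes from singletons to [a].  For [u ⊆ a] the relation
    [y = {x} ∩ u] is total from [a] to [B], so the set [c] which Subset
    Collection assigns to [a] and [B] has an element [d] that consists exactly
    of the slices [{x} ∩ u], [x ∈ a]; and [u] is the union of its slices.
    Therefore the set of the unions [⋃d], [d ∈ c], contains every subset of [a]
    ([powerset_bound]), and bounded Separation cuts it down to the power set.

    The derivations are written in a Kripke style.  A formula is derived from
    [Γ] as soon as it is derivable from every [Δ ⊇ Γ] that also derives the
    assumptions in force, and a universal formula as soon as all its instances
    are ([all_intro], by taking a variable that is fresh for [Γ]).  Thus the
    variables of the object language are represented by metavariables of type
    [nat], hypotheses by facts [prv Γ φ], and no index shifting is visible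
    except inside quantified formulas, where a metavariable [x] under [n]
    binders is written with [n] successors. *)

(** * Renaming and weakening *)

Lemma ren_ext_bound φ : forall f g,
  (forall n, n < bound φ -> f n = g n) -> ren f φ = ren g φ.
Proof.
  assert (Hup : forall φ f g, (forall n, n < Nat.pred (bound φ) -> f n = g n) ->
                 forall n, n < bound φ -> up f n = up g n).
  { intros ψ f g H [|n] Hn; [reflexivity|]. cbn. rewrite H; [reflexivity|lia]. }
  induction φ; intros f g H; cbn in *;
    try (rewrite (IHφ1 f g), (IHφ2 f g) by (intros; apply H; lia));
    try (rewrite (IHφ _ _ (Hup _ _ _ H)));
    try (rewrite !H by lia); reflexivity.
Qed.

Lemma ren_ext f g φ : (forall n, f n = g n) -> ren f φ = ren g φ.
Proof. intros H. apply ren_ext_bound. auto. Qed.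

Lemma ren_comp φ : forall f g, ren f (ren g φ) = ren (fun n => f (g n)) φ.
Proof.
  assert (Hup : forall f g n, up f (up g n) = up (fun n => f (g n)) n)
    by (intros f g [|n]; reflexivity).
  induction φ; intros f g; cbn; try rewrite IHφ; try rewrite IHφ1, IHφ2;
    try reflexivity; f_equal; apply ren_ext; apply Hup.
Qed.

Lemma ren_id f φ : (forall n, n < bound φ -> f n = n) -> ren f φ = φ.
Proof.
  intros H. transitivity (ren (fun n => n) φ); [now apply ren_ext_bound|].
  clear f H.
  assert (Hup : forall n, up (fun n => n) n = n) by (intros [|n]; reflexivity).
  induction φ; cbn; try rewrite IHφ1, IHφ2; try reflexivity;
    rewrite (ren_ext _ _ _ Hup), IHφ; reflexivity.
Qed.

Lemma ren_shift f φ : ren (up f) (shift φ) = shift (ren f φ).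
Proof. unfold shift. rewrite !ren_comp. now apply ren_ext. Qed.

Lemma ren_inst f t φ : ren f (inst t φ) = inst (f t) (ren (up f) φ).
Proof. unfold inst. rewrite !ren_comp. apply ren_ext. now intros [|n]. Qed.

Lemma inst_shift t φ : inst t (shift φ) = φ.
Proof. unfold inst, shift. rewrite ren_comp. now apply ren_id. Qed.

Lemma map_ren_shift f Γ :
  map (ren (up f)) (map shift Γ) = map shift (map (ren f) Γ).
Proof. rewrite !map_map. apply map_ext, ren_shift. Qed.

Lemma prv_ren Γ φ : prv Γ φ -> forall f, prv (map (ren f) Γ) (ren f φ).
Proof.
  induction 1; intros f; cbn in *.
  - apply prv_hyp, in_map. assumption.
  - apply prv_botE, IHprv.
  - now apply prv_andI.
  - eapply prv_andEl, IHprv.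
  - eapply prv_andEr, IHprv.
  - now apply prv_orIl.
  - now apply prv_orIr.
  - eapply prv_orE; [apply IHprv1|apply IHprv2|apply IHprv3].
  - apply prv_impI, IHprv.
  - eapply prv_impE; [apply IHprv1|apply IHprv2].
  - apply prv_allI. rewrite <- map_ren_shift. apply IHprv.
  - rewrite ren_inst. apply prv_allE, IHprv.
  - apply prv_exI with (f t). rewrite <- ren_inst. apply IHprv.
  - eapply prv_exE; [apply IHprv1|].
    rewrite <- map_ren_shift, <- ren_shift. apply (IHprv2 (up f)).
  - apply prv_eqI.
  - rewrite ren_inst. apply prv_eqE with (f s); [apply IHprv1|].
    rewrite <- ren_inst. apply IHprv2.
Qed.

Lemma prv_weaken Γ Δ φ : incl Γ Δ -> prv Γ φ -> prv Δ φ.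
Proof.
  intros HΔ H. revert Δ HΔ.
  assert (Hcons : forall (φ : form) Γ Δ, incl Γ Δ -> incl (φ :: Γ) (φ :: Δ)).
  { intros ψ Γ' Δ' HΔ. apply incl_cons; [now left|now apply incl_tl]. }
  induction H; intros Δ HΔ.
  - apply prv_hyp. auto.
  - apply prv_botE. auto.
  - apply prv_andI; auto.
  - eapply prv_andEl. eauto.
  - eapply prv_andEr. eauto.
  - apply prv_orIl. auto.
  - apply prv_orIr. auto.
  - eapply prv_orE; eauto.
  - apply prv_impI. auto.
  - eapply prv_impE; eauto.
  - apply prv_allI. auto using incl_map.
  - apply prv_allE. auto.
  - apply prv_exI with t. auto.
  - eapply prv_exE; [eauto|]. auto using incl_map.
  - apply prv_eqI.
  - apply prv_eqE with s; auto.
Qed.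

(** * Kripke-style rules *)

Definition fresh (k : nat) (Γ : list form) : Prop :=
  forall φ, In φ Γ -> bound φ <= k.

Lemma fresh_exists Γ φ : exists k, fresh k (φ :: Γ).
Proof.
  exists (list_max (map bound (φ :: Γ))). intros ψ Hψ.
  pose proof (proj1 (list_max_le (map bound (φ :: Γ)) _) (le_n _)) as H.
  rewrite Forall_forall in H. apply H, in_map, Hψ.
Qed.

(** Binds the variable [k]: the inverse of instantiation by a fresh [k], which
    shifts the formulas that do not mention [k]. *)
Definition abstract (k n : nat) : nat := if n =? k then 0 else S n.

Lemma ren_abstract_shift k φ : bound φ <= k -> ren (abstract k) φ = shift φ.
Proof.
  intros H. apply ren_ext_bound. intros n Hn. unfold abstract.
  destruct (Nat.eqb_spec n k); [lia|reflexivity].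
Qed.

Lemma ren_abstract_inst k φ :
  bound (All φ) <= k -> ren (abstract k) (inst k φ) = φ.
Proof.
  intros H. unfold inst. rewrite ren_comp. apply ren_id.
  unfold abstract. intros [|n] Hn; cbn in *; [now rewrite Nat.eqb_refl|].
  destruct (Nat.eqb_spec n k); [lia|reflexivity].
Qed.

Lemma map_abstract_shift k Γ :
  fresh k Γ -> map (ren (abstract k)) Γ = map shift Γ.
Proof.
  intros H. apply map_ext_in. intros φ Hφ. apply ren_abstract_shift, H, Hφ.
Qed.

(** Only finitely many variables are free in [Γ] and [φ], so the instance at a
    variable that is free in neither is derivable, and that variable can be
    bound. *)
Lemma all_intro Γ φ : (forall t, prv Γ (inst t φ)) -> prv Γ (All φ).
Proof.
  intros H. destruct (fresh_exists Γ (All φ)) as [k Hk].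
  apply prv_allI.
  rewrite <- (map_abstract_shift k Γ) by (intros ψ Hψ; apply Hk; now right).
  rewrite <- (ren_abstract_inst k φ) by (apply Hk; now left).
  apply prv_ren, H.
Qed.

Lemma imp_intro Γ φ ψ :
  (forall Δ, incl Γ Δ -> prv Δ φ -> prv Δ ψ) -> prv Γ (φ ⇒ ψ).
Proof.
  intros H. apply prv_impI, H; [now apply incl_tl|apply prv_hyp; now left].
Qed.

Lemma ex_elim Γ φ χ : prv Γ (Ex φ) ->
  (forall t Δ, incl Γ Δ -> prv Δ (inst t φ) -> prv Δ χ) -> prv Γ χ.
Proof.
  intros Hex H. apply prv_exE with φ; [exact Hex|].
  assert (Hall : prv Γ (All (φ ⇒ shift χ))).
  { apply all_intro. intros t. apply (imp_intro _ (inst t φ) (inst t (shift χ))).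
    intros Δ HΔ Hφ. rewrite inst_shift. exact (H t Δ HΔ Hφ). }
  (* Below the binder, the shifted universal formula is instantiated by the
     bound variable itself. *)
  assert (Heq : inst 0 (ren (up S) (φ ⇒ shift χ)) = (φ ⇒ shift χ)).
  { unfold inst. rewrite ren_comp. apply ren_id. now intros [|n]. }
  apply prv_impE with φ; [|apply prv_hyp; now left].
  apply prv_weaken with (map shift Γ); [now apply incl_tl|].
  rewrite <- Heq. apply prv_allE, (prv_ren _ _ Hall S).
Qed.

Lemma allin_intro Γ a φ :
  (forall t Δ, incl Γ Δ -> prv Δ (t ∈ a) -> prv Δ (inst t φ)) ->
  prv Γ (AllIn a φ).
Proof. intros H. apply all_intro. intros t. apply imp_intro. exact (H t). Qed.

Lemma allin_elim Γ a φ t : prv Γ (AllIn a φ) -> prv Γ (t ∈ a) -> prv Γ (inst t φ).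
Proof. intros H. exact (prv_impE _ _ _ (prv_allE _ _ t H)). Qed.

Lemma exin_intro Γ a φ t : prv Γ (t ∈ a) -> prv Γ (inst t φ) -> prv Γ (ExIn a φ).
Proof. intros Ha Hφ. exact (prv_exI _ (0 ∈ S a ∧ φ) t (prv_andI _ _ _ Ha Hφ)). Qed.

Lemma exin_elim Γ a φ χ : prv Γ (ExIn a φ) ->
  (forall t Δ, incl Γ Δ -> prv Δ (t ∈ a) -> prv Δ (inst t φ) -> prv Δ χ) ->
  prv Γ χ.
Proof.
  intros Hex H. apply (ex_elim _ _ _ Hex). intros t Δ HΔ Ht.
  exact (H t Δ HΔ (prv_andEl _ _ _ Ht) (prv_andEr _ _ _ Ht)).
Qed.

Lemma iff_intro Γ φ ψ :
  (forall Δ, incl Γ Δ -> prv Δ φ -> prv Δ ψ) ->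
  (forall Δ, incl Γ Δ -> prv Δ ψ -> prv Δ φ) -> prv Γ (φ ⇔ ψ).
Proof. intros H1 H2. apply prv_andI; now apply imp_intro. Qed.

Lemma iff_fwd Γ φ ψ : prv Γ (φ ⇔ ψ) -> prv Γ φ -> prv Γ ψ.
Proof. intros H. exact (prv_impE _ _ _ (prv_andEl _ _ _ H)). Qed.

Lemma iff_bwd Γ φ ψ : prv Γ (φ ⇔ ψ) -> prv Γ ψ -> prv Γ φ.
Proof. intros H. exact (prv_impE _ _ _ (prv_andEr _ _ _ H)). Qed.

Lemma eq_sym Γ s t : prv Γ (s ≐ t) -> prv Γ (t ≐ s).
Proof. intros H. exact (prv_eqE _ (0 ≐ S s) s t H (prv_eqI _ s)). Qed.

Lemma mem_eq Γ s t a : prv Γ (s ≐ t) -> prv Γ (s ∈ a) -> prv Γ (t ∈ a).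
Proof. exact (prv_eqE _ (0 ∈ S a) s t). Qed.

Lemma ext_intro Γ s t : prv Γ Extensionality ->
  (forall z Δ, incl Γ Δ -> prv Δ (z ∈ s) -> prv Δ (z ∈ t)) ->
  (forall z Δ, incl Γ Δ -> prv Δ (z ∈ t) -> prv Δ (z ∈ s)) -> prv Γ (s ≐ t).
Proof.
  intros Hext H1 H2.
  apply (prv_impE _ _ _ (prv_allE _ _ t (prv_allE _ _ s Hext))).
  apply all_intro. intros z. exact (iff_intro _ (z ∈ s) (z ∈ t) (H1 z) (H2 z)).
Qed.

(** Introduces an extension of the current context and carries all derived
    facts over to it. *)
Ltac extend_context :=
  let Δ := fresh "Δ" in let HΔ := fresh "HΔ" in
  intros Δ HΔ;
  repeat match type of HΔ with
         | incl ?Γ _ =>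
           match goal with K : prv Γ _ |- _ => apply (prv_weaken _ _ _ HΔ) in K end
         end;
  match type of HΔ with incl ?Γ _ => clear HΔ; try clear Γ; rename Δ into Γ end.

(** * A set of all subsets of the singletons of elements *)

(** [s ⊆ {x}]. *)
Definition subsingleton (s x : nat) : form := AllIn s (0 ≐ S x).

(** [P({x}) ⊆ y]. *)
Definition covers (y x : nat) : form := All (subsingleton 0 (S x) ⇒ 0 ∈ S y).

Lemma covers_elim Γ y x s :
  prv Γ (covers y x) -> prv Γ (subsingleton s x) -> prv Γ (s ∈ y).
Proof. intros H. exact (prv_impE _ _ _ (prv_allE _ _ s H)). Qed.

Lemma empty_set Γ (x : nat) : prv Γ (Separation Bot) -> prv Γ (Ex (All (¬ 0 ∈ 1))).
Proof.
  intros Hsep. apply (ex_elim _ _ _ (prv_allE _ _ x Hsep)).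
  intros e. extend_context. intros He.
  apply prv_exI with e, all_intro. intros z. apply imp_intro.
  extend_context. intros Hz.
  exact (prv_andEr _ _ _ (iff_fwd _ _ _ (prv_allE _ _ z He) Hz)).
Qed.

Lemma singleton Γ x :
  prv Γ Pairing -> prv Γ (Ex (All (0 ∈ 1 ⇔ 0 ≐ S (S x)))).
Proof.
  intros Hpair. apply (ex_elim _ _ _ (prv_allE _ _ x (prv_allE _ _ x Hpair))).
  intros t. extend_context. intros Ht.
  apply prv_exI with t, all_intro. intros z. apply iff_intro.
  - extend_context. intros Hz.
    apply (prv_orE _ _ _ _ (iff_fwd _ _ _ (prv_allE _ _ z Ht) Hz));
      apply prv_hyp; now left.
  - extend_context. intros Hz.
    exact (iff_bwd _ _ _ (prv_allE _ _ z Ht) (prv_orIl _ _ _ Hz)).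
Qed.

(** A subset [s] of [{x}] with [¬ s ∈ {∅, {x}}] would not contain [x], since
    otherwise [s = {x}]; but then [s = ∅]. *)
Lemma subsets_of_singleton Γ x :
  prv Γ Extensionality -> prv Γ Pairing -> prv Γ (Separation Bot) ->
  prv Γ DCom -> prv Γ (Ex (covers 0 (S x))).
Proof.
  intros Hext Hpair Hsep Hdc.
  (* The sets [e = ∅], [t = {x}], [p = {e, t}], and a double complement [y] of
     [p]. *)
  apply (ex_elim _ _ _ (empty_set _ x Hsep)). intros e. extend_context. intros He.
  apply (ex_elim _ _ _ (singleton _ x Hpair)). intros t. extend_context. intros Ht.
  apply (ex_elim _ _ _ (prv_allE _ _ t (prv_allE _ _ e Hpair))).
  intros p. extend_context. intros Hp.
  apply (ex_elim _ _ _ (prv_allE _ _ p Hdc)). intros y. extend_context. intros Hy.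
  apply prv_exI with y, all_intro. intros s. apply imp_intro.
  extend_context. intros Hs. change (prv Γ (s ∈ y)).
  apply (prv_impE _ _ _ (prv_allE _ _ s Hy)).
  apply (imp_intro _ (¬ s ∈ p)). extend_context. intros Hnot.
  assert (Hx : prv Γ (¬ x ∈ s)).
  { apply imp_intro. extend_context. intros Hx.
    apply (prv_impE _ _ _ Hnot), (iff_bwd _ _ _ (prv_allE _ _ s Hp)), prv_orIr.
    apply (ext_intro _ s t Hext); intros z; extend_context; intros Hz.
    - exact (iff_bwd _ _ _ (prv_allE _ _ z Ht) (allin_elim _ _ _ z Hs Hz)).
    - pose proof (iff_fwd _ _ _ (prv_allE _ _ z Ht) Hz : prv Γ (z ≐ x)) as Hzx.
      exact (mem_eq _ _ _ _ (eq_sym _ _ _ Hzx) Hx). }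
  apply (prv_impE _ _ _ Hnot), (iff_bwd _ _ _ (prv_allE _ _ s Hp)), prv_orIl.
  apply (ext_intro _ s e Hext); intros z; extend_context; intros Hz; apply prv_botE.
  - pose proof (allin_elim _ _ _ z Hs Hz : prv Γ (z ≐ x)) as Hzx.
    exact (prv_impE _ _ _ Hx (mem_eq _ _ _ _ Hzx Hz)).
  - exact (prv_impE _ _ _ (prv_allE _ _ z He) Hz).
Qed.

Lemma subsets_of_singletons Γ a :
  prv Γ Extensionality -> prv Γ Pairing -> prv Γ Union ->
  prv Γ (Separation Bot) -> prv Γ (StrongCollection (covers 0 1)) ->
  prv Γ DCom -> prv Γ (Ex (AllIn (S a) (covers 1 0))).
Proof.
  intros Hext Hpair Hunion Hsep Hcoll Hdc.
  assert (Htotal : prv Γ (AllIn a (Ex (covers 0 1)))).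
  { apply allin_intro. intros x. extend_context. intros _.
    now apply subsets_of_singleton. }
  apply (ex_elim _ _ _ (prv_impE _ _ _ (prv_allE _ _ a Hcoll) Htotal)).
  intros b. extend_context. intros Hb.
  apply (ex_elim _ _ _ (prv_allE _ _ b Hunion)). intros B. extend_context. intros HB.
  apply prv_exI with B, allin_intro. intros x. extend_context. intros Hx.
  apply all_intro. intros s. apply imp_intro. extend_context. intros Hs.
  apply (exin_elim _ _ _ _ (allin_elim _ _ _ x (prv_andEl _ _ _ Hb) Hx)).
  intros y. extend_context. intros Hy Hyx.
  apply (iff_bwd _ _ _ (prv_allE _ _ s HB)), (exin_intro _ _ _ y Hy).
  exact (covers_elim _ y x s Hyx Hs).
Qed.

(** * Slices and the power set *)

(** [y = {x} ∩ u]. *)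
Definition slice (y u x : nat) : form := All (0 ∈ S y ⇔ 0 ∈ S u ∧ 0 ≐ S x).

(** [w = ⋃d]. *)
Definition is_union (w d : nat) : form := All (0 ∈ S w ⇔ ExIn (S d) (1 ∈ 0)).

Definition subset (u a : nat) : form := AllIn u (0 ∈ S a).

Lemma slice_subsingleton Γ y u x : prv Γ (slice y u x) -> prv Γ (subsingleton y x).
Proof.
  intros Hy. apply allin_intro. intros z. extend_context. intros Hz.
  exact (prv_andEr _ _ _ (iff_fwd _ _ _ (prv_allE _ _ z Hy) Hz)).
Qed.

(** If [d] consists of the sets [{x} ∩ u], [x ∈ a], and [u ⊆ a], then [⋃d = u]:
    each [z ∈ u] lies in its own slice [{z} ∩ u]. *)
Lemma union_of_slices Γ a u d w :
  prv Γ Extensionality -> prv Γ (subset u a) ->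
  prv Γ (AllIn a (ExIn (S d) (slice 0 (S (S u)) 1))) ->
  prv Γ (AllIn d (ExIn (S a) (slice 1 (S (S u)) 0))) ->
  prv Γ (is_union w d) -> prv Γ (w ≐ u).
Proof.
  intros Hext Hu Had Hda Hw.
  apply (ext_intro _ w u Hext); intros z; extend_context; intros Hz.
  - apply (exin_elim _ _ _ _ (iff_fwd _ _ _ (prv_allE _ _ z Hw) Hz)).
    intros y. extend_context. intros Hy Hzy.
    apply (exin_elim _ _ _ _ (allin_elim _ _ _ y Hda Hy)).
    intros x. extend_context. intros _ Hslice.
    exact (prv_andEl _ _ _ (iff_fwd _ _ _ (prv_allE _ _ z Hslice) Hzy)).
  - pose proof (allin_elim _ _ _ z Hu Hz : prv Γ (z ∈ a)) as Hza.
    apply (exin_elim _ _ _ _ (allin_elim _ _ _ z Had Hza)).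
    intros y. extend_context. intros Hy Hslice.
    apply (iff_bwd _ _ _ (prv_allE _ _ z Hw)), (exin_intro _ _ _ y Hy).
    exact (iff_bwd _ _ _ (prv_allE _ _ z Hslice)
             (prv_andI _ _ _ Hz (prv_eqI _ z))).
Qed.

(** Subset Collection, for the relation [y = {x} ∩ u] between [x ∈ a] and
    [y ∈ B], gives a set [c] that contains for each [u ⊆ a] the set of slices of
    [u]; then [P] is the set of the unions of the members of [c].  Subset
    Collection returns only ranges of relations, not graphs.  This is why [u] is
    cut into the sets [{x} ∩ u] rather than coded by the truth values of
    [x ∈ u]: the slices determine [u] without ordered pairs [(x, y)]. *)
Lemma powerset_bound Γ a :
  prv Γ Extensionality -> prv Γ Union -> prv Γ (All (Separation (0 ≐ 2))) ->
  prv Γ (StrongCollection (is_union 0 1)) ->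
  prv Γ (SubsetCollection (slice 0 2 1)) ->
  prv Γ (Ex (AllIn (S a) (covers 1 0))) ->
  prv Γ (Ex (All (subset 0 (S (S a)) ⇒ 0 ∈ 1))).
Proof.
  intros Hext Hunion Hsep Hcoll Hsubcoll Hcovers.
  apply (ex_elim _ _ _ Hcovers). intros B. extend_context. intros HB.
  apply (ex_elim _ _ _ (prv_allE _ _ B (prv_allE _ _ a Hsubcoll))).
  intros c. extend_context. intros Hc.
  assert (Htotal : prv Γ (AllIn c (Ex (is_union 0 1)))).
  { apply allin_intro. intros d. extend_context. intros _.
    exact (prv_allE _ _ d Hunion). }
  apply (ex_elim _ _ _ (prv_impE _ _ _ (prv_allE _ _ c Hcoll) Htotal)).
  intros P. extend_context. intros HP.
  apply prv_exI with P, all_intro. intros u.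
  apply (imp_intro _ (subset u a) (u ∈ P)). extend_context. intros Hu.
  assert (Hslices : prv Γ (AllIn a (ExIn (S B) (slice 0 (S (S u)) 1)))).
  { apply allin_intro. intros x. extend_context. intros Hx.
    apply (ex_elim _ _ _ (prv_allE _ _ u (prv_allE _ _ x Hsep))).
    intros y. extend_context. intros Hy. apply exin_intro with y; [|exact Hy].
    exact (covers_elim _ _ _ _ (allin_elim _ _ _ x HB Hx)
             (slice_subsingleton _ _ _ _ Hy)). }
  apply (exin_elim _ _ _ _ (prv_impE _ _ _ (prv_allE _ _ u Hc) Hslices)).
  intros d. extend_context. intros Hd Hdu.
  apply (exin_elim _ _ _ _ (allin_elim _ _ _ d (prv_andEl _ _ _ HP) Hd)).
  intros w. extend_context. intros HwP Hw.
  apply mem_eq with w; [|exact HwP].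
  exact (union_of_slices _ a u d w Hext Hu
           (prv_andEl _ _ _ Hdu) (prv_andEr _ _ _ Hdu) Hw).
Qed.

Lemma powerset_from_bound Γ a :
  prv Γ (All (Separation (subset 0 2))) ->
  prv Γ (Ex (All (subset 0 (S (S a)) ⇒ 0 ∈ 1))) ->
  prv Γ (Ex (All (0 ∈ 1 ⇔ subset 0 (S (S a))))).
Proof.
  intros Hsep Hbound.
  apply (ex_elim _ _ _ Hbound). intros P. extend_context. intros HP.
  apply (ex_elim _ _ _ (prv_allE _ _ P (prv_allE _ _ a Hsep))).
  intros y. extend_context. intros Hy.
  apply prv_exI with y, all_intro. intros u.
  apply (iff_intro _ (u ∈ y) (subset u a)); extend_context; intros Hu.
  - exact (prv_andEr _ _ _ (iff_fwd _ _ _ (prv_allE _ _ u Hy) Hu)).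
  - exact (iff_bwd _ _ _ (prv_allE _ _ u Hy)
             (prv_andI _ _ _ (prv_impE _ _ _ (prv_allE _ _ u HP) Hu) Hu)).
Qed.

(** * The theorem *)

(** The instances with a leading quantifier are the closures of instances of
    Separation with one parameter; all other instances are closed already, so
    that [closure] leaves them as they are. *)
Definition axioms : list form :=
  [Extensionality; Pairing; Union; Separation Bot;
   All (Separation (0 ≐ 2)); All (Separation (subset 0 2));
   StrongCollection (covers 0 1); StrongCollection (is_union 0 1);
   SubsetCollection (slice 0 2 1); DCom].

Lemma axioms_in_theory φ : In φ axioms -> extend CZF DCom φ.
Proof.
  intros H; cbn [axioms In] in H.
  repeat destruct H as [<-|H]; [left..|now right|contradiction].
  - constructor.
  - constructor.
  - constructor.
  - apply (CZF_separation Bot). constructor.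
  - apply (CZF_separation (0 ≐ 2)). constructor.
  - apply (CZF_separation (subset 0 2)). repeat constructor.
  - apply (CZF_strong_collection (covers 0 1)).
  - apply (CZF_strong_collection (is_union 0 1)).
  - apply (CZF_subset_collection (slice 0 2 1)).
Qed.

Theorem corollary3p8 : proves (extend CZF DCom) Pow.
Proof.
  exists axioms. split; [exact axioms_in_theory|].
  apply all_intro. intros a. apply powerset_from_bound.
  2: apply powerset_bound; [..|apply subsets_of_singletons].
  all: apply prv_hyp; cbn [axioms In]; tauto.
Qed.
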